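(* Consider $6$-colourings of the $2\times3$-block with vertices $v_1,\dots,v_6$ and boundary vertices $z_1,\dots,z_{10}$, where $z_1$ is adjacent to the corner vertex $v_1$. Then $p^{\mathrm{low}}_{v_1}\ge 0.3671$, $p^{\mathrm{low}}_{v_3}\ge 0.0298$, $p^{\mathrm{low}}_{v_4}\ge 0.0997$ and $p^{\mathrm{low}}_{v_6}\ge 0.0174$.
   Context: The block is a $2\times3$ sub-grid of the square lattice whose vertices are labelled row by row: first row $v_1,v_2,v_3$, second row $v_4,v_5,v_6$. So the adjacencies inside the block are $v_1v_2$, $v_2v_3$, $v_4v_5$, $v_5v_6$, $v_1v_4$, $v_2v_5$, $v_3v_6$. The boundary consists of the ten lattice vertices $z_1,\dots,z_{10}$ outside the block that are adjacent to some block vertex; each corner $v_1,v_3,v_4,v_6$ is adjacent to exactly two boundary vertices, each of $v_2,v_5$ is adjacent to exactly one, each boundary vertex is adjacent to exactly one block vertex, and $z_1$ is adjacent to $v_1$ (how $z_2,\dots,z_{10}$ are labelled is immaterial). A boundary colouring is any function $Z:\{z_1,\dots,z_{10}\}\to\{1,\dots,6\}$. A proper $6$-colouring of the block agrees with $Z$ if adjacent block vertices have different colours and each block vertex has a colour different from the colours under $Z$ of its adjacent boundary vertices. Let $\pi_Z$ be the uniform distribution on the proper $6$-colourings of the block that agree with $Z$. For boundary colourings $Z,Z'$ and a coupling $\Psi$ of $\pi_Z$ and $\pi_{Z'}$, let $p_{v}(\Psi)$ be the probability that the colour of block vertex $v$ differs in the pair of colourings drawn from $\Psi$. Define $$p^{\mathrm{low}}_{v}=\max_{Z,Z'}\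 \min_{\Psi}\ p_{v}(\Psi),$$ where the maximum is over all pairs $Z,Z'$ of boundary colourings that agree on every boundary vertex except $z_1$, on which they differ, and the minimum is over all couplings $\Psi$ of $\pi_Z$ and $\pi_{Z'}$. *)

(* Defs.v *)
From HB Require Import structures.
From mathcomp Require Import all_boot all_order all_algebra.
From mathcomp Require Import boolp classical_sets reals.

Set Implicit Arguments.
Unset Strict Implicit.
Unset Printing Implicit Defensive.

Import Order.TTheory GRing.Theory Num.Theory.

Local Open Scope classical_set_scope.
Local Open Scope ring_scope.

Definition colour := 'I_6.

(* The element of value i stands for the vertex v_(i+1), resp. z_(i+1). *)
Definition block := 'I_6.
Definition boundary := 'I_10.

Definition v1 : block := @Ordinal 6 0 isT.
Definition v3 : block := @Ordinal 6 2 isT.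
Definition v4 : block := @Ordinal 6 3 isT.
Definition v6 : block := @Ordinal 6 5 isT.
Definition z1 : boundary := @Ordinal 10 0 isT.

(* Pairs of indices i of the v_i; each edge is listed once. *)
Definition block_edges : seq (nat * nat) :=
  [:: (1, 2); (2, 3); (4, 5); (5, 6); (1, 4); (2, 5); (3, 6)]%N.

Definition block_adj : rel block := fun u v =>
  ((u.+1, v.+1) \in block_edges) || ((v.+1, u.+1) \in block_edges).

(* The j-th entry is the index i of the unique v_i adjacent to z_j, for the
   z_j numbered clockwise around the block; z_1 and z_10 are the two
   neighbours of v_1. *)
Definition boundary_neighbours : seq nat := [:: 1; 2; 3; 3; 6; 6; 5; 4; 4; 1]%N.

Definition boundary_adj (z : boundary) (v : block) : bool :=
  nth 0%N boundary_neighbours z == v.+1.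

Definition block_colouring := {ffun block -> colour}.
Definition boundary_colouring := {ffun boundary -> colour}.

Definition is_proper (c : block_colouring) : bool :=
  [forall u, forall v, block_adj u v ==> (c u != c v)].

Definition agrees (Z : boundary_colouring) (c : block_colouring) : bool :=
  [forall z, forall v, boundary_adj z v ==> (c v != Z z)].

Definition agreeing_colourings (Z : boundary_colouring) :
    {set block_colouring} :=
  [set c | is_proper c && agrees Z c]%SET.

Section Couplings.
Variable R : realType.

Definition pi_ (Z : boundary_colouring) (c : block_colouring) : R :=
  if c \in agreeing_colourings Z then #|agreeing_colourings Z|%:R^-1 else 0.

Definition couplings (Z Z' : boundary_colouring) :
    set (block_colouring -> block_colouring -> R) :=
  [set Psi | [/\ forall c c' : block_colouring, 0 <= Psi c c',
                 forall c : block_colouring, \sum_c' Psi c c' = pi_ Z c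
               & forall c' : block_colouring, \sum_c Psi c c' = pi_ Z' c']].

Definition disagreement (v : block)
    (Psi : block_colouring -> block_colouring -> R) : R :=
  \sum_(c : block_colouring) \sum_(c' : block_colouring | c v != c' v)
    Psi c c'.

(* The least element of A; it is 0 by convention if there is none. *)
Definition minimum (A : set R) : R := xget 0 (A `&` lbound A).

Definition differ_only_at_z1 (Z Z' : boundary_colouring) : bool :=
  [forall z, (Z z != Z' z) == (z == z1)].

(* The base value 0 of the maximum is harmless: all terms are nonnegative. *)
Definition p_low (v : block) : R :=
  \big[Num.max/0]_(ZZ : boundary_colouring * boundary_colouring
                     | differ_only_at_z1 ZZ.1 ZZ.2)
     minimum [set disagreement v Psi | Psi in couplings ZZ.1 ZZ.2].

End Couplings.

(* Main.v *)
(* For fixed Z and Z', the least probability that the colours of v differ is the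
   total variation distance between the laws of the colour of v under pi_Z and
   pi_Z': couple equal colours as often as possible, couple the excess masses
   independently, then lift to block colourings by conditioning on the colour
   of v. That distance is at least P_Z(c v = k) - P_Z'(c v = k) for any colour
   k, so one pair (Z, Z') and one colour k per vertex, found by computer
   search, together with an enumeration of the agreeing colourings, suffice. *)
Require Import Defs.
From mathcomp Require Import all_boot all_order all_algebra.
From mathcomp Require Import boolp classical_sets reals.
From mathcomp Require Import lra zify.

Set Implicit Arguments.
Unset Strict Implicit.
Unset Printing Implicit Defensive.

Import Order.TTheory GRing.Theory Num.Theory.

Local Open Scope ring_scope.

(** * Total variation distance and optimal couplings for the law of an observable [f] *)

Section OptimalCoupling.
Variables (R : realType) (T K : finType) (f : T -> K) (p q : T -> R).
Hypotheses (p_ge0 : forall c, 0 <= p c) (q_ge0 : forall c, 0 <= q c).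
Hypotheses (p_sum1 : \sum_c p c = 1) (q_sum1 : \sum_c q c = 1).

Definition marginal (r : T -> R) (k : K) : R := \sum_(c | f c == k) r c.

Definition overlap (k : K) : R := Num.min (marginal p k) (marginal q k).

(** The total variation distance between the laws of [f] under [p] and [q]. *)
Definition tv : R := 1 - \sum_k overlap k.

Lemma marginal_ge0 (r : T -> R) k : (forall c, 0 <= r c) -> 0 <= marginal r k.
Proof. by move=> r_ge0; apply: sumr_ge0. Qed.

Lemma marginal_sum (r : T -> R) : \sum_k marginal r k = \sum_c r c.
Proof. by rewrite [RHS](partition_big f predT). Qed.

Lemma marginal_eq0 (r : T -> R) c :
  (forall c, 0 <= r c) -> marginal r (f c) = 0 -> r c = 0.
Proof.
move=> r_ge0 /eqP; rewrite psumr_eq0 // => /allP /(_ c (mem_index_enum c)).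
by rewrite eqxx => /eqP.
Qed.

(** On a null fibre the quotient is [0] by convention, which is harmless because [r] vanishes
    there. *)
Lemma marginal_mulV (r : T -> R) c : (forall c, 0 <= r c) ->
  r c / marginal r (f c) * marginal r (f c) = r c.
Proof.
move=> r_ge0; have [m0|m0] := eqVneq (marginal r (f c)) 0.
  by rewrite (marginal_eq0 r_ge0 m0) !mul0r.
by rewrite divfK.
Qed.

(** The overlap sits on the diagonal; the excesses, each of total mass [tv], are coupled as a
    normalised product. *)
Definition colour_coupling (k l : K) : R :=
  (if k == l then overlap k else 0) +
  (marginal p k - overlap k) * (marginal q l - overlap l) / tv.

(** Given their colours, [c] and [c'] are drawn independently from the conditional laws of [p] and
    [q]. *)
Definition optimal_coupling (c c' : T) : R :=
  p c / marginal p (f c) * (q c' / marginal q (f c')) *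
  colour_coupling (f c) (f c').

Lemma overlap_lel k : overlap k <= marginal p k.
Proof. by rewrite /overlap ge_min lexx. Qed.

Lemma overlap_ler k : overlap k <= marginal q k.
Proof. by rewrite /overlap ge_min lexx orbT. Qed.

Lemma overlap_ge0 k : 0 <= overlap k.
Proof. by rewrite /overlap le_min !marginal_ge0. Qed.

Lemma tvEl : tv = \sum_k (marginal p k - overlap k).
Proof. by rewrite sumrB marginal_sum p_sum1. Qed.

Lemma tvEr : tv = \sum_k (marginal q k - overlap k).
Proof. by rewrite sumrB marginal_sum q_sum1. Qed.

Lemma tv_ge0 : 0 <= tv.
Proof. by rewrite tvEl sumr_ge0 // => k _; rewrite subr_ge0 overlap_lel. Qed.

Lemma tv_eq0l k : tv = 0 -> marginal p k - overlap k = 0.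
Proof.
move/eqP; rewrite tvEl psumr_eq0 => [/allP /(_ k (mem_index_enum k)) /eqP //|].
by move=> i _; rewrite subr_ge0 overlap_lel.
Qed.

Lemma tv_eq0r k : tv = 0 -> marginal q k - overlap k = 0.
Proof.
move/eqP; rewrite tvEr psumr_eq0 => [/allP /(_ k (mem_index_enum k)) /eqP //|].
by move=> i _; rewrite subr_ge0 overlap_ler.
Qed.

Lemma colour_coupling_ge0 k l : 0 <= colour_coupling k l.
Proof.
rewrite addr_ge0 //; first by case: ifP => // _; apply: overlap_ge0.
by rewrite divr_ge0 ?tv_ge0 // mulr_ge0 // subr_ge0 ?overlap_lel ?overlap_ler.
Qed.

Lemma colour_coupling_suml k : \sum_l colour_coupling k l = marginal p k.
Proof.
rewrite big_split /= -big_mkcond /= (eq_bigl _ _ (eq_sym k)) big_pred1_eq.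
rewrite -mulr_suml -mulr_sumr -tvEr.
(* If [tv] is [0], the product term is a division by zero, but every excess vanishes as well. *)
have [tv0|tv0] := eqVneq tv 0; last by rewrite mulfK // addrC subrK.
by rewrite tv0 mulr0 mul0r addr0; apply/esym/eqP; rewrite -subr_eq0 tv_eq0l.
Qed.

Lemma colour_coupling_sumr l : \sum_k colour_coupling k l = marginal q l.
Proof.
rewrite big_split /= -big_mkcond /= big_pred1_eq.
rewrite -mulr_suml -mulr_suml -tvEl.
have [tv0|tv0] := eqVneq tv 0; last first.
  by rewrite mulrAC divff // mul1r addrC subrK.
by rewrite tv0 !mul0r addr0; apply/esym/eqP; rewrite -subr_eq0 tv_eq0r.
Qed.

(** The overlap is a minimum, so one of the two excesses at [k] is zero. *)
Lemma colour_coupling_diag k : colour_coupling k k = overlap k.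
Proof.
rewrite /colour_coupling eqxx /overlap.
by case: leP => _; rewrite subrr ?mulr0 !mul0r addr0.
Qed.

Lemma colour_coupling_eq0l k l : marginal p k = 0 -> colour_coupling k l = 0.
Proof.
rewrite -colour_coupling_suml => /eqP; rewrite psumr_eq0 => [|i _].
  by move=> /allP /(_ l (mem_index_enum l)) /eqP.
exact: colour_coupling_ge0.
Qed.

Lemma colour_coupling_eq0r k l : marginal q l = 0 -> colour_coupling k l = 0.
Proof.
rewrite -colour_coupling_sumr => /eqP; rewrite psumr_eq0 => [|i _].
  by move=> /allP /(_ k (mem_index_enum k)) /eqP.
exact: colour_coupling_ge0.
Qed.

(** A conditional law has mass one on each non-null fibre; the hypothesis makes null fibres
    contribute nothing on either side. *)
Lemma sum_conditional (r : T -> R) (F : K -> R) :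
  (forall k, marginal r k = 0 -> F k = 0) ->
  \sum_c r c / marginal r (f c) * F (f c) = \sum_k F k.
Proof.
move=> F0; rewrite (partition_big f predT) //=; apply: eq_bigr => k _.
rewrite (eq_bigr (fun c => r c / marginal r k * F k)) => [|c /eqP-> //].
rewrite -mulr_suml -mulr_suml -/(marginal r k).
have [m0|m0] := eqVneq (marginal r k) 0; first by rewrite (F0 k m0) mulr0.
by rewrite divff // mul1r.
Qed.

Lemma optimal_coupling_ge0 c c' : 0 <= optimal_coupling c c'.
Proof. by rewrite !mulr_ge0 ?invr_ge0 ?marginal_ge0 ?colour_coupling_ge0. Qed.

Lemma optimal_coupling_suml c : \sum_c' optimal_coupling c c' = p c.
Proof.
under eq_bigr do rewrite /optimal_coupling -mulrA.
rewrite -mulr_sumr (sum_conditional (F := colour_coupling (f c))) => [|l].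
  by rewrite colour_coupling_suml marginal_mulV.
exact: colour_coupling_eq0r.
Qed.

Lemma optimal_coupling_sumr c' : \sum_c optimal_coupling c c' = q c'.
Proof.
under eq_bigr do rewrite /optimal_coupling mulrAC.
rewrite -mulr_suml (sum_conditional (F := colour_coupling^~ (f c'))) => [|k].
  by rewrite colour_coupling_sumr mulrC marginal_mulV.
exact: colour_coupling_eq0l.
Qed.

(** Summing out both conditional laws leaves the off-diagonal mass of [colour_coupling]; row [k]
    contributes its marginal minus its diagonal entry, the excess of [p] at [k]. *)
Lemma optimal_coupling_disagreement :
  \sum_c \sum_(c' | f c != f c') optimal_coupling c c' = tv.
Proof.
pose off k l := if k != l then colour_coupling k l else 0.
have -> : \sum_c \sum_(c' | f c != f c') optimal_coupling c c' =
          \sum_c p c / marginal p (f c) * \sum_l off (f c) l.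
  apply: eq_bigr => c _; rewrite -(sum_conditional (r := q)) => [|l m0].
    rewrite mulr_sumr big_mkcond; apply: eq_bigr => c' _.
    by rewrite /off /optimal_coupling; case: ifP => _; rewrite ?mulr0 ?mulrA.
  by rewrite /off colour_coupling_eq0r // if_same.
rewrite (sum_conditional (F := fun k => \sum_l off k l)) => [|k m0]; last first.
  by apply: big1 => l _; rewrite /off colour_coupling_eq0l // if_same.
rewrite tvEl; apply: eq_bigr => k _; rewrite /off -big_mkcond /=.
rewrite -(colour_coupling_suml k) [in RHS](bigD1 k) //=.
rewrite colour_coupling_diag addrAC subrr add0r.
by apply: eq_bigl => l; rewrite eq_sym.
Qed.

(** The mass on which both colours equal [k] is at most either marginal at [k], hence at most the
    overlap; the remaining mass is disagreement. *)
Lemma tv_le_disagreement (Psi : T -> T -> R) :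
  (forall c c', 0 <= Psi c c') -> (forall c, \sum_c' Psi c c' = p c) ->
  (forall c', \sum_c Psi c c' = q c') ->
  tv <= \sum_c \sum_(c' | f c != f c') Psi c c'.
Proof.
move=> Psi_ge0 Psi_p Psi_q; rewrite lerBlDr -p_sum1.
rewrite -(eq_bigr _ (fun c _ => Psi_p c)).
rewrite (eq_bigr (fun c => \sum_(c' | f c != f c') Psi c c' +
                           \sum_(c' | f c' == f c) Psi c c')); last first.
  move=> c _; rewrite (bigID (fun c' => f c != f c')) /=; congr (_ + _).
  by apply: eq_bigl => c'; rewrite negbK eq_sym.
rewrite big_split lerD2l (partition_big f predT) //=; apply: ler_sum => k _.
have eqk c : f c == k -> \sum_(c' | f c' == f c) Psi c c' =
                         \sum_(c' | f c' == k) Psi c c' by move/eqP->.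
rewrite (eq_bigr _ eqk) le_min; apply/andP; split.
  apply: ler_sum => c _; rewrite -Psi_p [leRHS](bigID (fun c' => f c' == k)) /=.
  by rewrite lerDl sumr_ge0.
rewrite exchange_big /=; apply: ler_sum => c' _.
rewrite -Psi_q [leRHS](bigID (fun c => f c == k)) /=.
by rewrite lerDl sumr_ge0.
Qed.

(** Keep only the term at [k] in the sum of the nonnegative excesses of [p]. *)
Lemma le_tv k : marginal p k - marginal q k <= tv.
Proof.
rewrite tvEl (bigD1 k) //= -[leLHS]addr0 lerD //.
  by rewrite lerD2l lerN2 overlap_ler.
by rewrite sumr_ge0 // => i _; rewrite subr_ge0 overlap_lel.
Qed.

End OptimalCoupling.

(** * From the uniform laws to a lower bound on [p_low] by counts *)

Section UniformDistribution.
Variables (R : realType) (Z : boundary_colouring).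

Lemma pi_ge0 c : 0 <= pi_ R Z c.
Proof. by rewrite /pi_; case: ifP => // _; rewrite invr_ge0 ler0n. Qed.

Lemma sum_pi (P : pred block_colouring) :
  \sum_(c | P c) pi_ R Z c =
  #|[set c in agreeing_colourings Z | P c]|%:R / #|agreeing_colourings Z|%:R.
Proof.
rewrite /pi_ -big_mkcondr sumr_const -[LHS]mulr_natl; congr (_%:R * _).
by apply: eq_card => c; rewrite [RHS]finset.in_set andbC.
Qed.

Lemma sum_pi1 : (0 < #|agreeing_colourings Z|)%N -> \sum_c pi_ R Z c = 1.
Proof.
move=> A_gt0; rewrite sum_pi (_ : [set c in _ | _] = agreeing_colourings Z).
  by rewrite divff // pnatr_eq0 -lt0n.
by apply/setP => c; rewrite !inE andbT.
Qed.

End UniformDistribution.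

Lemma minimum_eq (R : realType) (A : set R) (x : R) :
  A x -> lbound A x -> minimum A = x.
Proof.
move=> Ax lbx; rewrite /minimum; apply: xget_unique => [|y [Ay lby]].
  by split.
by apply/le_anti; rewrite lby // lbx.
Qed.

(** The optimal coupling attains the bound that holds for all couplings. Nonemptiness makes both
    uniform laws have mass one. *)
Lemma minimum_disagreement (R : realType) (Z Z' : boundary_colouring)
    (v : block) :
  (0 < #|agreeing_colourings Z|)%N -> (0 < #|agreeing_colourings Z'|)%N ->
  minimum [set disagreement v Psi | Psi in @couplings R Z Z']%classic =
  tv (fun c : block_colouring => c v) (pi_ R Z) (pi_ R Z').
Proof.
move=> A_gt0 A'_gt0; have [p0 q0] := (@pi_ge0 R Z, @pi_ge0 R Z').
have [p1 q1] := (@sum_pi1 R Z A_gt0, @sum_pi1 R Z' A'_gt0).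
apply: minimum_eq.
  exists (optimal_coupling (fun c : block_colouring => c v)
            (pi_ R Z) (pi_ R Z')).
    split=> *; first exact: optimal_coupling_ge0.
      exact: optimal_coupling_suml.
    exact: optimal_coupling_sumr.
  exact: optimal_coupling_disagreement.
by move=> _ [Psi [? ? ?] <-]; apply: tv_le_disagreement.
Qed.

Lemma le_p_low (R : realType) (Z Z' : boundary_colouring) (v : block)
    (k : colour) :
  differ_only_at_z1 Z Z' ->
  (0 < #|agreeing_colourings Z|)%N -> (0 < #|agreeing_colourings Z'|)%N ->
  #|[set c in agreeing_colourings Z | c v == k]|%:R /
    #|agreeing_colourings Z|%:R -
  #|[set c in agreeing_colourings Z' | c v == k]|%:R /
    #|agreeing_colourings Z'|%:R <= p_low R v.
Proof.
move=> ZZ' A_gt0 A'_gt0; rewrite -!sum_pi.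
apply: le_trans (le_tv (fun c : block_colouring => c v) _ _ k) _.
- exact: sum_pi1.
rewrite -minimum_disagreement //.
exact: (le_bigmax_cond _ (fun ZZ : boundary_colouring * boundary_colouring =>
  minimum [set disagreement v Psi | Psi in @couplings R ZZ.1 ZZ.2]%classic)
  (j := (Z, Z'))).
Qed.

(** * Enumeration of the agreeing colourings as words *)

(** Here [s] colours the vertices after index [i], so its entry [j] belongs to index [i.+1 + j].
    Edges are listed with the smaller endpoint first, so looking forward from [i] suffices. *)
Definition colour_free (x : nat) (zs : seq nat) (i : nat) (s : seq nat) :
    bool :=
  all (fun z => (nth 0 boundary_neighbours z == i.+1) ==> (x != nth 0 zs z))
      (iota 0 10) &&
  all (fun j => ((i.+1, (i.+1 + j).+1) \in block_edges) ==> (x != nth 0 s j))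
      (iota 0 (size s)).

(* Lists the colourings of the [n] block vertices from index [i] on; pruning
   the partial colourings keeps the enumeration small. *)
Fixpoint block_words (zs : seq nat) (i n : nat) : seq (seq nat) :=
  if n is n'.+1 then
    [seq x :: s | s <- block_words zs i.+1 n',
                  x <- [seq x <- iota 0 6 | colour_free x zs i s]]
  else [:: [::]].

Lemma block_words_consE zs i n x s :
  (x :: s \in block_words zs i n.+1) =
  [&& s \in block_words zs i.+1 n, (x < 6)%N & colour_free x zs i s].
Proof.
apply/allpairsPdep/idP => [[s' [x' [s'P]]]|/and3P[sP x6 xf]].
  by rewrite mem_filter mem_iota => /and3P[xf _ x6] [-> ->]; apply/and3P.
by exists s, x; split; rewrite // mem_filter mem_iota x6 xf.
Qed.

Lemma block_words_uniq zs i n : uniq (block_words zs i n).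
Proof.
elim: n i => // n IHn i; apply: allpairs_uniq_dep => [//|s _|].
  by rewrite filter_uniq ?iota_uniq.
by move=> [s x] [s' x'] _ _ /= [-> ->].
Qed.

Lemma block_words_size zs i n s : s \in block_words zs i n -> size s = n.
Proof.
elim: n i s => [|n IHn] i s; first by rewrite inE => /eqP->.
by case/allpairsPdep=> s' [x [/IHn <- _ ->]].
Qed.

Lemma block_words_lt6 zs i n s :
  s \in block_words zs i n -> all (fun x => x < 6)%N s.
Proof.
elim: n i s => [|n IHn] i s; first by rewrite inE => /eqP->.
case/allpairsPdep=> s' [x [/IHn s'P]]; rewrite mem_filter mem_iota.
by move=> /and3P[_ _ x6] -> /=; apply/andP.
Qed.

(** * Correspondence between agreeing colourings and enumerated words *)

Section Counting.
Variables (Z : boundary_colouring) (zs : seq nat).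
Hypothesis zsE : forall z : boundary, nth 0%N zs z = Z z.

Definition colour_word (c : block_colouring) (i n : nat) : seq nat :=
  [seq val (c (inord j)) | j <- iota i n].

Definition word_colouring (s : seq nat) : block_colouring :=
  [ffun u : block => inord (nth 0%N s u)].

Lemma nth_colour_word (c : block_colouring) i n j :
  (j < n)%N -> nth 0%N (colour_word c i n) j = c (inord (i + j)).
Proof. by move=> jn; rewrite (nth_map 0%N) ?size_iota // nth_iota. Qed.

Lemma colour_wordK c : word_colouring (colour_word c 0 6) = c.
Proof.
by apply/ffunP => u; rewrite ffunE nth_colour_word // add0n !inord_val.
Qed.

Lemma word_colouringK s :
  s \in block_words zs 0 6 -> colour_word (word_colouring s) 0 6 = s.
Proof.
move=> sP; have s6 := block_words_size sP; apply: (@eq_from_nth _ 0%N) => [|j].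
  by rewrite size_map size_iota s6.
rewrite size_map size_iota => j6; rewrite nth_colour_word // add0n ffunE.
by rewrite !inordK // (allP (block_words_lt6 sP)) // mem_nth ?s6.
Qed.

(** The constraints are restricted to the window of [n] indices from [i], so that induction on [n]
    adds just those of the new first vertex. *)
Lemma colour_word_in (c : block_colouring) i n :
  reflect
    (forall j, (i <= j < i + n)%N ->
      (forall z, (z < 10)%N -> nth 0%N boundary_neighbours z = j.+1 ->
         val (c (inord j)) != nth 0%N zs z) /\
      (forall k, (j < k < i + n)%N -> (j.+1, k.+1) \in block_edges ->
         c (inord j) != c (inord k)))
    (colour_word c i n \in block_words zs i n).
Proof.
elim: n i => [|n IHn] i; first by apply: ReflectT => j; lia.
rewrite [colour_word _ _ _]/= block_words_consE ltn_ord /=.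
apply: (iffP andP) => [[/IHn cP /andP[/allP cz /allP cc]] j ij|cP].
  have [ji|ji] := eqVneq j i; last first.
    have [|jz jP] := cP j; first lia.
    by split=> // k jk; apply: jP; lia.
  rewrite {j ij}ji; split=> [z z10 zi|k ik e].
    by apply: (implyP (cz z _)); rewrite ?mem_iota ?zi.
  (* Vertex [k] is entry [k - i.+1] of the tail. *)
  have := cc (k - i.+1)%N; rewrite mem_iota size_map size_iota.
  rewrite nth_colour_word ?subnKC ?e; [|lia..].
  by move=> /(_ _)/implyP; apply => //; lia.
split.
  apply/IHn => j ij; have [|jz jP] := cP j; first lia.
  by split=> // k jk; apply: jP; lia.
have [|cz cc] := cP i; first lia.
apply/andP; split; apply/allP => z; rewrite mem_iota => z10; apply/implyP.
  by move/eqP=> zi; apply: cz.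
rewrite size_map size_iota in z10; rewrite nth_colour_word // => e.
by apply: cc => //; lia.
Qed.

Lemma mem_agreeing c :
  (c \in agreeing_colourings Z) = (colour_word c 0 6 \in block_words zs 0 6).
Proof.
(* This orientation reduces the symmetric [block_adj] to the forward constraints of
   [colour_word_in]. *)
have edge_lt u v : (u.+1, v.+1) \in block_edges -> (u < v)%N.
  have /allP lt_edges : all (fun e => e.1 < e.2)%N block_edges by [].
  by move/lt_edges.
rewrite finset.in_set; apply/andP/colour_word_in.
  move=> [/forallP cp /forallP ca] j j6; split=> [z z10 zj|k jk e].
    have /forallP/(_ (inord j))/implyP := ca (inord z).
    rewrite /boundary_adj !inordK ?zj // => /(_ (eqxx _)).
    by rewrite -val_eqE /= -zsE inordK.
  have /forallP/(_ (inord k))/implyP := cp (inord j).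
  by apply; rewrite /block_adj !inordK ?e //; lia.
move=> cP.
have c_edge u v : (u.+1, v.+1) \in block_edges -> (v < 6)%N ->
    c (inord u) != c (inord v).
  by move=> e v6; have [|_] := cP u; [|apply] => //; have := edge_lt _ _ e; lia.
split.
  apply/forallP => u; apply/forallP => v; apply/implyP => /orP[] e.
    by have := c_edge _ _ e (ltn_ord v); rewrite !inord_val.
  by have := c_edge _ _ e (ltn_ord u); rewrite !inord_val eq_sym.
apply/forallP => z; apply/forallP => u; apply/implyP => /eqP zu.
have [|+ _] := cP u; first by rewrite ltn_ord.
by move=> /(_ z (ltn_ord z) zu); rewrite inord_val zsE val_eqE.
Qed.

(** [colour_word] is injective, with inverse [word_colouring], and maps onto the duplicate-free list
    of words satisfying [P]. *)
Lemma card_agreeing (P : pred (seq nat)) :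
  #|[set c in agreeing_colourings Z | P (colour_word c 0 6)]| =
  count P (block_words zs 0 6).
Proof.
rewrite cardE -(size_map (fun c => colour_word c 0 6)) -size_filter.
apply/perm_size/uniq_perm => [||s].
- by rewrite (map_inj_uniq (can_inj colour_wordK)) enum_uniq.
- by rewrite filter_uniq ?block_words_uniq.
rewrite mem_filter; apply/mapP/andP => [[c + ->]|[Ps sP]].
  by rewrite mem_enum finset.in_set mem_agreeing => /andP[].
exists (word_colouring s); last by rewrite word_colouringK.
by rewrite mem_enum finset.in_set mem_agreeing word_colouringK ?sP.
Qed.

Lemma card_agreeing_at (v : block) (k : colour) :
  #|[set c in agreeing_colourings Z | c v == k]| =
  count (fun s => nth 0%N s v == k) (block_words zs 0 6).
Proof.
rewrite -card_agreeing; congr #|pred_of_set _|; apply/setP => c.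
by rewrite !finset.in_set nth_colour_word // add0n inord_val.
Qed.

Lemma card_agreeing_all : #|agreeing_colourings Z| = size (block_words zs 0 6).
Proof.
rewrite -count_predT -card_agreeing; congr #|pred_of_set _|; apply/setP => c.
by rewrite finset.in_set andbT.
Qed.

End Counting.

(** * Explicit boundary colourings and their counts *)

(* [x] colours z_1, and [t] lists the colours of z_2, ..., z_10. *)
Definition witness (x : nat) (t : seq nat) : boundary_colouring :=
  [ffun z : boundary => inord (nth 0 (x :: t) z)%N].

Lemma witnessE x t : all (fun y => y < 6)%N (x :: t) ->
  forall z : boundary, nth 0%N (x :: t) z = witness x t z.
Proof.
move=> /allP xt6 z; rewrite ffunE inordK //.
(* Past the end of the list the default [0] is itself a valid colour. *)
have [zlt|zge] := ltnP z (size (x :: t)); last by rewrite nth_default.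
by rewrite xt6 ?mem_nth.
Qed.

Lemma witness_differ t : differ_only_at_z1 (witness 0 t) (witness 1 t).
Proof.
apply/forallP => -[[|z] zlt]; last by rewrite !ffunE /= eqxx.
by rewrite !ffunE -val_eqE /= !inordK.
Qed.

(** The counts enter through equations, so each is checked by computation on [nat] while the bound
    keeps literal fractions. *)
Lemma p_low_witness (R : realType) (t : seq nat) (v : block) (k : colour)
    (m n m' n' : nat) :
  all (fun y => y < 6)%N t -> (0 < n)%N -> (0 < n')%N ->
  count (fun s => nth 0 s v == k)%N (block_words (0 :: t)%N 0 6) = m ->
  size (block_words (0 :: t)%N 0 6) = n ->
  count (fun s => nth 0 s v == k)%N (block_words (1 :: t)%N 0 6) = m' ->
  size (block_words (1 :: t)%N 0 6) = n' ->
  m%:R / n%:R - m'%:R / n'%:R <= p_low R v.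
Proof.
move=> t6 n0 n'0 mE nE m'E n'E.
have E0 := @witnessE 0 t t6; have E1 := @witnessE 1 t t6.
have mC := etrans (card_agreeing_at E0 v k) mE.
have nC := etrans (card_agreeing_all E0) nE.
have m'C := etrans (card_agreeing_at E1 v k) m'E.
have n'C := etrans (card_agreeing_all E1) n'E.
rewrite -mC -nC -m'C -n'C; apply: le_p_low (witness_differ t) _ _.
  by rewrite nC.
by rewrite n'C.
Qed.

Theorem lemma7 (R : realType) :
  [/\ 3671 / 10 ^+ 4 <= p_low R v1,
      298 / 10 ^+ 4 <= p_low R v3,
      997 / 10 ^+ 4 <= p_low R v4
    & 174 / 10 ^+ 4 <= p_low R v6].
Proof.
split.
(* Each fraction is the share of agreeing colourings giving [v] the colour [k], with [z1] coloured
   [0] and then [1]. Here the second count is zero because [z1] forbids colour [1] at [v1]. The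
   chosen [k] is [1] at even distance from [v1] and [0] at odd distance. *)
- apply: (@le_trans _ _ (723%:R / 1969%:R - 0%:R / 1865%:R)); first by lra.
  apply: (@p_low_witness R [:: 1; 4; 2; 3; 0; 5; 0; 1; 3]%N v1
    (@Ordinal 6 1 isT));
    by vm_compute.
- apply: (@le_trans _ _ (440%:R / 1452%:R - 401%:R / 1468%:R)); first by lra.
  apply: (@p_low_witness R [:: 2; 2; 5; 1; 5; 1; 0; 1; 2]%N v3
    (@Ordinal 6 1 isT));
    by vm_compute.
- apply: (@le_trans _ _ (596%:R / 1655%:R - 444%:R / 1705%:R)); first by lra.
  apply: (@p_low_witness R [:: 0; 3; 4; 4; 5; 0; 3; 2; 2]%N v4 ord0);
    by vm_compute.
(* The totals agree because colours [0] and [1] do not occur in the list, so swapping them exchanges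
   the two boundary colourings. *)
- apply: (@le_trans _ _ (353%:R / 1315%:R - 330%:R / 1315%:R)); first by lra.
  apply: (@p_low_witness R [:: 2; 5; 2; 5; 2; 2; 2; 4; 2]%N v6 ord0);
    by vm_compute.
Qed.
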